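(* Let $(E,\langle\cdot,\cdot\rangle,\Theta)$ be a pre-Courant algebroid, let $\mathcal{S}_1,\mathcal{S}_2,\mathcal{S}_3$ be endomorphisms of $E$ and set $\mathcal{T}_i:=\varepsilon_{i-1}\mathcal{S}_{i-1}\mathcal{S}_{i+1}$ (indices in $\mathbb{Z}_3$). The triplet $(\mathcal{S}_1,\mathcal{S}_2,\mathcal{S}_3)$ is a hypersymplectic (resp., para-hypersymplectic) structure on $(E,\Theta)$ if and only if $(\mathcal{S}_1,\mathcal{T}_2,\mathcal{T}_3)$ is a hypersymplectic (resp., para-hypersymplectic) structure on $(E,\Theta)$. Furthermore, both (para-)hypersymplectic structures determine equal or opposite pseudo-metrics.
   Context: Let $E\to M$ be a real vector bundle over a smooth manifold with a fibrewise non-degenerate symmetric bilinear form $\langle\cdot,\cdot\rangle$. A pre-Courant structure $\Theta$ on $(E,\langle\cdot,\cdot\rangle)$ is a pair $(\rho,[\cdot,\cdot])$, where $\rho:E\to TM$ is a vector bundle morphism (anchor) and $[\cdot,\cdot]:\Gamma(E)\times\Gamma(E)\to\Gamma(E)$ is an $\mathbb{R}$-bilinear (not necessarily skew-symmetric) bracket with $\rho(X)\cdot\langle Y,Z\rangle=\langle[X,Y],Z\rangle+\langle Y,[X,Z]\rangle$ and $\rho(X)\cdot\langle Y,Z\rangle=\langle X,[Y,Z]+[Z,Y]\rangle$ for all $X,Y,Z\in\Gamma(E)$. Endomorphisms of $E$ are vector bundle morphisms over $\mathrm{id}_M$; juxtaposition is composition; $\mathcal{I}$ is skew-symmetric if $\langle\mathcal{I}u,v\rangle=-\langle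 u,\mathcal{I}v\rangle$. The deformation of $\Theta=(\rho,[\cdot,\cdot])$ by $\mathcal{I}$ is $\Theta_{\mathcal{I}}=(\rho\circ\mathcal{I},[\cdot,\cdot]_{\mathcal{I}})$, $[X,Y]_{\mathcal{I}}=[\mathcal{I}X,Y]+[X,\mathcal{I}Y]-\mathcal{I}[X,Y]$ (again pre-Courant if $\mathcal{I}$ is skew-symmetric), and $\Theta_{\mathcal{I},\mathcal{J}}=(\Theta_{\mathcal{I}})_{\mathcal{J}}$; $c\,\Theta=(c\rho,c[\cdot,\cdot])$ for $c\in\mathbb{R}$. For $\boldsymbol{\varepsilon}=(\varepsilon_1,\varepsilon_2,\varepsilon_3)$, $\varepsilon_i=\pm1$, an $\boldsymbol{\varepsilon}$-hypersymplectic structure on $(E,\Theta)$ is a triplet $(\mathcal{S}_1,\mathcal{S}_2,\mathcal{S}_3)$ of skew-symmetric endomorphisms of $E$ such that (i) $\mathcal{S}_i^2=\varepsilon_i\,\mathrm{id}_E$; (ii) $\mathcal{S}_i\mathcal{S}_j=\varepsilon_1\varepsilon_2\varepsilon_3\,\mathcal{S}_j\mathcal{S}_i$ for $i\ne j$; (iii) $\Theta_{\mathcal{S}_i,\mathcal{S}_i}=\varepsilon_i\Theta$, for $i,j\in\{1,2,3\}$. It is called hypersymplectic if $\boldsymbol{\varepsilon}=(-1,-1,-1)$, and para-hypersymplectic if $\varepsilon_1\varepsilon_2\varepsilon_3=-1$ with not all $\varepsilon_i$ equal to $-1$; by convention (after a cyclic permutation of indices) para-hypersymplectic structures have $\boldsymbol{\varepsilon}=(1,1,-1)$.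 In the definition of $\mathcal{T}_i$ the signs are those of the case considered. The pseudo-metric determined by a (para-)hypersymplectic structure $(\mathcal{S}_1,\mathcal{S}_2,\mathcal{S}_3)$ is the endomorphism $\mathcal{G}=\mathcal{S}_3\mathcal{S}_2\mathcal{S}_1$ (a symmetric, orthogonal automorphism of $E$); ''opposite'' means differing by the sign $-1$. Indices are taken in $\mathbb{Z}_3=\{1,2,3\}$. *)

(* Defs.v *)
From HB Require Import structures.
From mathcomp Require Import all_boot all_order all_algebra.
From mathcomp Require Import all_classical all_reals all_analysis.
Set Implicit Arguments. Unset Strict Implicit. Unset Printing Implicit Defensive.
Import Order.TTheory GRing.Theory Num.Theory.
Import numFieldNormedType.Exports.
Local Open Scope classical_set_scope.
Local Open Scope ring_scope.

Section Calculus.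
Context {R : realType}.
Implicit Types V W X : normedModType R.

(* f is of class C^k on the set U (always open below): for k > 0, f is
   differentiable at every point of U and its derivative in each fixed
   direction v is of class C^(k-1) on U *)
Fixpoint Cn_on (k : nat) {V W} (U : set V) (f : V -> W) : Prop :=
  if k is k'.+1 then
    (forall x, U x -> differentiable f x) /\
    (forall v, Cn_on k' U (fun x => 'd f x v))
  else forall x, U x -> {for x, continuous f}.

Definition smooth_on {V W} (U : set V) (f : V -> W) := forall k, Cn_on k U f.

Lemma near_eq_is_diff V W (f g : V -> W) x :
  (\forall y \near x, f y = g y) -> differentiable f x ->
  differentiable g x /\ 'd g x = 'd f x :> (V -> W).
Proof.
move=> fg df; have fgx : f x = g x by exact: (nbhs_singleton fg).
have dg : g \o shift x = cst (g x) + 'd f x +o_ 0 id.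
  apply/eqaddoP => e e0.
  have /eqaddoP/(_ e e0) H := diff_locally df.
  have fg0 : \forall h \near (0 : V), f (h + x) = g (h + x).
    have C : (fun h : V => h + x) @ (0 : V) --> (0 : V) + x.
      by apply: cvgD; [exact: cvg_id|exact: cvg_cst].
    have C' : (fun h : V => h + x) @ (0 : V) --> x by rewrite -[X in _ --> X]add0r.
    exact: (C' _ fg).
  apply: filterS2 fg0 H => h E.
  rewrite -[(_ - _) h]/(f (h + x) - (f x + 'd f x h)).
  by rewrite -[(_ - _) h]/(g (h + x) - (g x + 'd f x h)) E fgx.
have E := diff_unique (diff_continuous df) dg.
by split=> //; apply/diff_locallyP; rewrite E; split => //; exact: diff_continuous.
Qed.

Lemma diff_comp_near V W X (f : V -> W) (h : W -> X) (e : V -> X) p q v :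
  f p = q -> differentiable f p -> differentiable h q ->
  (\forall y \near p, h (f y) = e y) -> 'd h q ('d f p v) = 'd e p v.
Proof.
move=> <- df dh hfe.
have [_ ->] := near_eq_is_diff (f := h \o f) hfe (differentiable_comp df dh).
by rewrite (diff_comp df dh).
Qed.

Lemma Cn_on_sub k V W (U U' : set V) (f : V -> W) :
  U `<=` U' -> Cn_on k U' f -> Cn_on k U f.
Proof.
elim: k f => [|k IH] f sU /=; first by move=> H x /sU/H.
by move=> [H1 H2]; split => [x /sU/H1//|v]; exact: IH.
Qed.

Lemma Cn_on_eq k V W (U : set V) (f g : V -> W) :
  open U -> (forall x, U x -> f x = g x) -> Cn_on k U f -> Cn_on k U g.
Proof.
move=> oU; elim: k f g => [|k IH] f g fg /=.
  move=> H x Ux; have := H x Ux.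
  have E : {near x, f =1 g}.
    by apply: filterS (open_nbhs_nbhs (conj oU Ux)) => y; exact: fg.
  move=> C; rewrite /prop_for /continuous_at -(fg x Ux); apply: cvg_trans C.
  by apply: near_eq_cvg; apply: filterS E => y ->.
have N x : U x -> \forall y \near x, f y = g y.
  by move=> Ux; apply: filterS (open_nbhs_nbhs (conj oU Ux)) => y; exact: fg.
move=> [H1 H2]; split=> [x Ux|v].
  by have [] := near_eq_is_diff (N x Ux) (H1 x Ux).
apply: IH (H2 v) => x Ux.
by have [_ ->] := near_eq_is_diff (N x Ux) (H1 x Ux).
Qed.

Lemma Cn_on_local k V W (U : set V) (f : V -> W) :
  (forall x, U x -> exists2 D : set V, D x & Cn_on k (U `&` D) f) ->
  Cn_on k U f.
Proof.
elim: k f => [|k IH] f H /=.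
  by move=> x Ux; have [D Dx HD] := H x Ux; exact: HD.
split=> [x Ux|v]; first by have [D Dx [HD _]] := H x Ux; apply: HD.
by apply: IH => x Ux; have [D Dx [_ HD]] := H x Ux; exists D; last exact: (HD v).
Qed.

Lemma Cn_on_cst k V W (U : set V) (a : W) : Cn_on k U (fun=> a).
Proof.
elim: k a => [|k IH] a /=; first by move=> x _; exact: cst_continuous.
split=> [x _|v]; first exact: differentiable_cst.
have -> : (fun x : V => 'd (fun=> a) x v) = fun=> 0.
  by apply/funext => x; rewrite (diff_cst a x).
exact: IH.
Qed.

Lemma Cn_onD k V W (U : set V) (f g : V -> W) : open U ->
  Cn_on k U f -> Cn_on k U g -> Cn_on k U (fun x => f x + g x).
Proof.
move=> oU; elim: k f g => [|k IH] f g /=.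
  by move=> Hf Hg x Ux; apply: continuousD; [exact: Hf|exact: Hg].
move=> [f1 f2] [g1 g2]; split=> [x Ux|v].
  by apply: differentiableD; [exact: f1|exact: g1].
apply: Cn_on_eq (IH _ _ (f2 v) (g2 v)) => // x Ux.
by rewrite (diffD (f1 x Ux) (g1 x Ux)).
Qed.

Lemma Cn_on_sum k V W (U : set V) n (f : 'I_n -> V -> W) : open U ->
  (forall i, Cn_on k U (f i)) -> Cn_on k U (fun x => \sum_i f i x).
Proof.
move=> oU; elim: n f => [|n IH] f H.
  have -> : (fun x => \sum_(i < 0) f i x) = fun=> 0.
    by apply/funext => x; rewrite big_ord0.
  exact: Cn_on_cst.
have -> : (fun x => \sum_i f i x) =
    fun x => f ord0 x + \sum_i f (lift ord0 i) x.
  by apply/funext => x; rewrite big_ord_recl.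
by apply: Cn_onD => //; exact: IH.
Qed.

Lemma Cn_on_succ k V W (U : set V) (f : V -> W) :
  Cn_on k.+1 U f -> Cn_on k U f.
Proof.
elim: k f => [|k IH] f.
  by move=> [H _] x Ux; apply: differentiable_continuous; exact: H.
by move=> [H1 H2]; split=> // v; apply: IH; exact: H2.
Qed.

Lemma scale_is_bilinear W :
  bilinear_for (GRing.Scale.Law.clone _ _ *:%R _)
    (GRing.Scale.Law.clone _ _ *:%R _) (@GRing.scale R W).
Proof.
split=> [u'|u] a x y /=; first by rewrite scalerDl scalerA.
by rewrite scalerDr !scalerA mulrC.
Qed.

Lemma diff_scale V W (h : V -> R) (f : V -> W) x :
  differentiable h x -> differentiable f x ->
  differentiable (fun y => h y *: f y) x /\
  'd (fun y => h y *: f y) x = (fun v => h x *: 'd f x v + 'd h x v *: f x)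
    :> (V -> W).
Proof.
move=> dh df.
pose bm := bilinear_isBilinear.Build R R W W _ _ (@GRing.scale R W)
  (scale_is_bilinear W).
pose b : {bilinear R -> W -> W} := HB.pack (@GRing.scale R W) bm.
have bc : continuous (fun p : R * W => b p.1 p.2).
  by move=> p; exact: scale_continuous.
have dp := differentiable_pair dh df.
have db := differentiable_bilin (h x, f x) bc.
have E : (fun y => h y *: f y) =
    (fun p : R * W => b p.1 p.2) \o (fun y => (h y, f y)) by [].
rewrite E; split; first exact: differentiable_comp.
rewrite (diff_comp dp db) (diff_bilin _ bc) (diff_pair dh df).
exact/funext.
Qed.

Lemma Cn_onZ k V W (U : set V) (h : V -> R) (f : V -> W) : open U ->
  Cn_on k U h -> Cn_on k U f -> Cn_on k U (fun x => h x *: f x).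
Proof.
move=> oU; elim: k V W U oU h f => [|k IH] V W U oU h f.
  by move=> Hh Hf x Ux; apply: cvgZ; [exact: Hh|exact: Hf].
move=> Hh Hf; have [h1 h2] := Hh; have [f1 f2] := Hf; split=> [x Ux|v].
  by have [] := diff_scale (h1 x Ux) (f1 x Ux).
apply: (@Cn_on_eq _ _ _ _ (fun x => h x *: 'd f x v + 'd h x v *: f x)) => //.
  by move=> x Ux; have [_ ->] := diff_scale (h1 x Ux) (f1 x Ux).
apply: Cn_onD => //.
  by apply: (IH _ _ U oU h (fun x => 'd f x v)); [exact: Cn_on_succ|exact: f2].
by apply: (IH _ _ U oU (fun x => 'd h x v) f); [exact: h2|exact: Cn_on_succ].
Qed.

Lemma Cn_on_lin k V W X (U : set V) (l : {linear W -> X}) (f : V -> W) :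
  open U -> continuous l -> Cn_on k U f -> Cn_on k U (fun x => l (f x)).
Proof.
move=> oU lc; elim: k f => [|k IH] f.
  by move=> H x Ux; apply: continuous_comp; [exact: H|exact: lc].
move=> [f1 f2]; split=> [x Ux|v].
  by apply: differentiable_comp; [exact: f1|exact: linear_differentiable].
apply: Cn_on_eq (IH _ (f2 v)) => // x Ux.
rewrite (@diff_comp _ _ _ _ f l x) ?diff_lin //; first exact: f1.
exact: linear_differentiable.
Qed.

Lemma Cn_on_coord k V n (U : set V) (f : V -> 'rV[R]_n) i : open U ->
  Cn_on k U f -> Cn_on k U (fun x => f x ord0 i).
Proof.
move=> oU H.
have lin : linear (fun N : 'rV[R]_n => N ord0 i : R).
  by move=> a u v; rewrite !mxE.
pose lM := GRing.isLinear.Build _ _ _ _ _ lin.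
pose l : {linear 'rV[R]_n -> R} := HB.pack (fun N : 'rV[R]_n => N ord0 i : R) lM.
by apply: (@Cn_on_lin k _ _ _ U l f) => //; exact: coord_continuous.
Qed.

Lemma Cn_on_app k V n W (U : set V) (L : V -> 'rV[R]_n -> W)
    (h : V -> 'rV[R]_n) : open U -> (forall x, U x -> linear (L x)) ->
  (forall v, Cn_on k U (L^~ v)) -> Cn_on k U h -> Cn_on k U (fun x => L x (h x)).
Proof.
move=> oU linL HL Hh.
apply: (@Cn_on_eq _ _ _ _
  (fun x => \sum_(i < n) h x ord0 i *: L x (delta_mx ord0 i))) => //.
  move=> x Ux; pose lM := GRing.isLinear.Build _ _ _ _ _ (linL x Ux).
  pose l : {linear 'rV[R]_n -> W} := HB.pack (L x) lM.
  rewrite [in RHS](row_sum_delta (h x)) -[L x _ in RHS]/(l _) linear_sum.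
  by apply: eq_bigr => i _; rewrite linearZ.
apply: Cn_on_sum => // i; apply: Cn_onZ => //; exact: Cn_on_coord.
Qed.

Lemma Cn_on_comp k V n W (U : set V) (O : set 'rV[R]_n)
    (f : V -> 'rV[R]_n) (g : 'rV[R]_n -> W) :
  open U -> (forall x, U x -> O (f x)) ->
  Cn_on k U f -> Cn_on k O g -> Cn_on k U (g \o f).
Proof.
move=> oU fUO; elim: k f fUO g => [|k IH] f fUO g.
  by move=> Hf Hg x Ux; apply: continuous_comp; [exact: Hf|exact/Hg/fUO].
move=> Hf Hg; have [f1 f2] := Hf; have [g1 g2] := Hg; split=> [x Ux|v].
  by apply: differentiable_comp; [exact: f1|exact/g1/fUO].
apply: (@Cn_on_eq _ _ _ _ (fun x => 'd g (f x) ('d f x v))) => //.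
  by move=> x Ux; rewrite (diff_comp (f1 x Ux) (g1 _ (fUO x Ux))).
apply: (Cn_on_app (L := fun x => 'd g (f x))) => //.
  by move=> x Ux a u w; rewrite linearP.
by move=> w; apply: (IH f fUO (fun y => 'd g y w)); [exact: Cn_on_succ|exact: g2].
exact: f2.
Qed.

End Calculus.

Section Manifolds.
Context {R : realType}.

(* cinv is total for convenience; only its values on ccod are meaningful *)
Record chart (T : topologicalType) (n : nat) := Chart {
  cdom : set T ;
  ccod : set 'rV[R]_n ;
  cmap : T -> 'rV[R]_n ;
  cinv : 'rV[R]_n -> T ;
  cdom_open : open cdom ;
  ccod_open : open ccod ;
  cmap_cod : forall x, cdom x -> ccod (cmap x) ;
  cinv_dom : forall y, ccod y -> cdom (cinv y) ;
  cmapK : forall x, cdom x -> cinv (cmap x) = x ;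
  cinvK : forall y, ccod y -> cmap (cinv y) = y ;
  cmap_continuous : forall x, cdom x -> {for x, continuous cmap} ;
  cinv_continuous : forall y, ccod y -> {for y, continuous cinv} }.

(* the part of the codomain of the chart c that corresponds to U *)
Definition chart_part T n (c : chart T n) (U : set T) : set 'rV[R]_n :=
  [set y | ccod c y /\ U (cinv c y)].

Record smoothManifold := SmoothManifold {
  mcarrier :> topologicalType ;
  mdim : nat ;
  atlas : Type ;
  achart : atlas -> chart mcarrier mdim ;
  chart_at : mcarrier -> atlas ;
  chart_atP : forall x, cdom (achart (chart_at x)) x ;
  atlas_smooth : forall c c' : atlas,
    smooth_on (chart_part (achart c) (cdom (achart c')))
      (cmap (achart c') \o cinv (achart c)) ;
  manifold_hausdorff : hausdorff_space mcarrier ;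
  manifold_second_countable : @second_countable mcarrier }.

Lemma chart_part_open T n (c : chart T n) U : open U -> open (chart_part c U).
Proof.
move=> oU; rewrite openE => y [cy Uy]; rewrite /interior.
have H1 : nbhs y (ccod c) := open_nbhs_nbhs (conj (@ccod_open _ _ c) cy).
have H2 : nbhs y (cinv c @^-1` U).
  apply: (cinv_continuous cy).
  exact: (open_nbhs_nbhs (conj oU Uy : open_nbhs (cinv c y) U)).
exact: filterS2 H1 H2.
Qed.

Section Smooth.
Variable M : smoothManifold.
Implicit Type W : normedModType R.

Definition msmooth_on W (U : set M) (f : M -> W) :=
  forall c : atlas M, smooth_on (chart_part (achart c) U) (f \o cinv (achart c)).

Lemma msmooth_on_sub W (U U' : set M) (f : M -> W) :
  U `<=` U' -> msmooth_on U' f -> msmooth_on U f.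
Proof.
by move=> sU H c k; apply: Cn_on_sub (H c k) => y [cy Uy]; split=> //; exact: sU.
Qed.

Lemma msmooth_on_eq W (U : set M) (f g : M -> W) :
  open U -> (forall x, U x -> f x = g x) -> msmooth_on U f -> msmooth_on U g.
Proof.
move=> oU fg H c k; apply: Cn_on_eq (H c k); first exact: chart_part_open.
by move=> y [_ Uy] /=; exact: fg.
Qed.

Lemma msmooth_on_local W (U : set M) (f : M -> W) :
  (forall x, U x -> exists2 D : set M, D x & msmooth_on (U `&` D) f) ->
  msmooth_on U f.
Proof.
move=> H c k; apply: Cn_on_local => y [cy Uy]; have [D Dy HD] := H _ Uy.
exists (cinv (achart c) @^-1` D) => //; apply: Cn_on_sub (HD c k).
by move=> z [[cz Uz] Dz].
Qed.

Lemma msmooth_on_cst W (U : set M) (a : W) : msmooth_on U (fun=> a).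
Proof. by move=> c k; exact: Cn_on_cst. Qed.

Lemma msmooth_onD W (U : set M) (f g : M -> W) : open U ->
  msmooth_on U f -> msmooth_on U g -> msmooth_on U (fun x => f x + g x).
Proof.
move=> oU Hf Hg c k.
apply: (@Cn_onD _ _ _ _ _ (f \o cinv (achart c)) (g \o cinv (achart c))).
- exact: chart_part_open.
- exact: Hf.
- exact: Hg.
Qed.

Lemma msmooth_onZ W (U : set M) (a : R) (f : M -> W) : open U ->
  msmooth_on U f -> msmooth_on U (fun x => a *: f x).
Proof.
move=> oU Hf c k.
apply: (@Cn_onZ _ _ _ _ _ (fun=> a) (f \o cinv (achart c))).
- exact: chart_part_open.
- exact: Cn_on_cst.
- exact: Hf.
Qed.

Lemma msmooth_on_app n W (U : set M) (L : M -> 'rV[R]_n -> W)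
    (h : M -> 'rV[R]_n) : open U -> (forall x, U x -> linear (L x)) ->
  (forall v, msmooth_on U (L^~ v)) -> msmooth_on U h ->
  msmooth_on U (fun x => L x (h x)).
Proof.
move=> oU linL HL Hh c k.
apply: (@Cn_on_app _ _ _ _ _ _ (L \o cinv (achart c)) (h \o cinv (achart c))).
- exact: chart_part_open.
- by move=> y [_ Uy]; exact: linL.
- by move=> v; exact: HL.
- exact: Hh.
Qed.

End Smooth.

(* A smooth real vector bundle of finite rank, given by its fibres and its
   local trivializations: trivialization i identifies the fibre over each x in
   tdom i with R^rank, through tmap i x and its inverse tinv i x, and all
   transition functions are smooth. The total space gets its topology and
   smooth structure from these data. *)
Record vbundle (M : smoothManifold) := VBundle {
  rank : nat ;
  fib :> M -> lmodType R ;
  trivs : Type ;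
  tdom : trivs -> set M ;
  tmap : trivs -> forall x, fib x -> 'rV[R]_rank ;
  tinv : trivs -> forall x, 'rV[R]_rank -> fib x ;
  tdom_open : forall i, open (tdom i) ;
  tdom_cover : forall x, exists i, tdom i x ;
  tmap_linear : forall i x, tdom i x -> linear (@tmap i x) ;
  tmapK : forall i x, tdom i x -> cancel (@tmap i x) (@tinv i x) ;
  tinvK : forall i x, tdom i x -> cancel (@tinv i x) (@tmap i x) ;
  transition_smooth : forall i j v,
    msmooth_on (tdom i `&` tdom j) (fun x => @tmap j x (@tinv i x v)) }.

Arguments tdom {M E} i : rename.
Arguments tmap {M E} i {x} u : rename.
Arguments tinv {M E} i x w : rename.

Lemma tmap0 M (E : vbundle M) (i : trivs E) x :
  tdom i x -> tmap i (0 : E x) = 0.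
Proof.
move=> ix; have := tmap_linear ix (-1) 0 0.
by rewrite !scaleN1r oppr0 addr0 addNr.
Qed.

Lemma tmapZ M (E : vbundle M) (i : trivs E) x a (u : E x) :
  tdom i x -> tmap i (a *: u) = a *: tmap i u.
Proof. by move=> ix; have := tmap_linear ix a u 0; rewrite tmap0 // !addr0. Qed.

Lemma tinv_linear M (E : vbundle M) (i : trivs E) x :
  tdom i x -> linear (tinv i x).
Proof.
move=> ix a u v; apply: (can_inj (tmapK ix)).
by rewrite tinvK // tmap_linear // !tinvK.
Qed.

Record section M (E : vbundle M) := Section {
  sapp :> forall x, E x ;
  sapp_smooth : forall i : trivs E, msmooth_on (tdom i) (fun x => tmap i (sapp x)) }.

Lemma sectionP M (E : vbundle M) (X Y : section E) :
  (forall x, X x = Y x) -> X = Y.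
Proof.
case: X Y => [X HX] [Y HY] /= XY.
have E0 : X = Y by exact: functional_extensionality_dep.
by case: _ / E0 HY => HY; congr Section; exact: Prop_irrelevance.
Qed.

(* vector bundle morphisms over the identity; smoothness is that of the matrix
   entries in local trivializations *)
Record bundle_hom M (E F : vbundle M) := Hom {
  happ :> forall x, E x -> F x ;
  happ_linear : forall x, linear (happ (x := x)) ;
  happ_smooth : forall (i : trivs E) (j : trivs F) v,
    msmooth_on (tdom i `&` tdom j) (fun x => tmap j (happ (tinv i x v))) }.

Lemma homP M (E F : vbundle M) (f g : bundle_hom E F) :
  (forall x u, @f x u = @g x u) -> f = g.
Proof.
case: f g => [f Lf Hf] [g Lg Hg] /= fg.
have E0 : f = g.
  by apply: functional_extensionality_dep => x; apply/funext => u; exact: fg.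
by case: _ / E0 Lg Hg => Lg Hg; congr Hom; exact: Prop_irrelevance.
Qed.

Section SectionModule.
Variables (M : smoothManifold) (E : vbundle M).
Implicit Types X Y Z : section E.

Fact section0_smooth (i : trivs E) :
  msmooth_on (tdom i) (fun x => tmap i (0 : E x)).
Proof.
apply: msmooth_on_eq (msmooth_on_cst _ 0); first exact: tdom_open.
by move=> x ix; rewrite tmap0.
Qed.

Fact sectionD_smooth X Y (i : trivs E) :
  msmooth_on (tdom i) (fun x => tmap i (X x + Y x)).
Proof.
have oi := @tdom_open _ E i.
apply: msmooth_on_eq (msmooth_onD oi (sapp_smooth X i) (sapp_smooth Y i)) => //.
by move=> x ix; have := tmap_linear ix 1 (X x) (Y x); rewrite !scale1r.
Qed.

Fact sectionZ_smooth (a : R) X (i : trivs E) :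
  msmooth_on (tdom i) (fun x => tmap i (a *: X x)).
Proof.
have oi := @tdom_open _ E i.
apply: msmooth_on_eq (msmooth_onZ a oi (sapp_smooth X i)) => //.
by move=> x ix; rewrite tmapZ.
Qed.

Definition section0 := Section section0_smooth.
Definition sectionD X Y := Section (sectionD_smooth X Y).
Definition sectionZ a X := Section (sectionZ_smooth a X).
Definition sectionN X := sectionZ (-1) X.

HB.instance Definition _ := gen_eqMixin (section E).
HB.instance Definition _ := gen_choiceMixin (section E).

Fact sectionDA : associative sectionD.
Proof. by move=> X Y Z; apply: sectionP => x /=; rewrite addrA. Qed.
Fact sectionDC : commutative sectionD.
Proof. by move=> X Y; apply: sectionP => x /=; rewrite addrC. Qed.
Fact section0D : left_id section0 sectionD.
Proof. by move=> X; apply: sectionP => x /=; rewrite add0r. Qed.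
Fact sectionND : left_inverse section0 sectionN sectionD.
Proof. by move=> X; apply: sectionP => x /=; rewrite scaleN1r addNr. Qed.

HB.instance Definition _ := GRing.isZmodule.Build (section E)
  sectionDA sectionDC section0D sectionND.

Fact sectionZA a b X : sectionZ a (sectionZ b X) = sectionZ (a * b) X.
Proof. by apply: sectionP => x /=; rewrite scalerA. Qed.
Fact section1Z : left_id 1 sectionZ.
Proof. by move=> X; apply: sectionP => x /=; rewrite scale1r. Qed.
Fact sectionZDr : right_distributive sectionZ +%R.
Proof. by move=> a X Y; apply: sectionP => x /=; rewrite scalerDr. Qed.
Fact sectionZDl X : {morph sectionZ^~ X : a b / a + b}.
Proof. by move=> a b; apply: sectionP => x /=; rewrite scalerDl. Qed.

HB.instance Definition _ := GRing.Zmodule_isLmodule.Build R (section E)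
  sectionZA section1Z sectionZDr sectionZDl.

Lemma sectionDE X Y x : (X + Y) x = X x + Y x. Proof. by []. Qed.
Lemma sectionNE X x : (- X) x = - X x. Proof. exact: scaleN1r. Qed.
Lemma sectionZE a X x : (a *: X) x = a *: X x. Proof. by []. Qed.

End SectionModule.

Section HomOperations.
Variable M : smoothManifold.
Implicit Types E F G : vbundle M.

Fact hom_section_smooth E F (f : bundle_hom E F) (X : section E) (j : trivs F) :
  msmooth_on (tdom j) (fun x => tmap j (f x (X x))).
Proof.
apply: msmooth_on_local => x jx; have [i ix] := tdom_cover E x.
exists (tdom i) => //.
have oij : open (tdom j `&` tdom i) by apply: openI; exact: tdom_open.
apply: (@msmooth_on_eq _ _ _ (fun x => tmap j (f x (tinv i x (tmap i (X x)))))) => //.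
  by move=> y [jy iy]; rewrite tmapK.
apply: (msmooth_on_app (L := fun x v => tmap j (f x (tinv i x v)))) => //.
- move=> y [jy iy] a u v.
  by rewrite (tinv_linear iy) happ_linear tmap_linear.
- by move=> v; rewrite setIC; exact: happ_smooth.
- apply: msmooth_on_sub (sapp_smooth X i); exact: subIsetr.
Qed.

Definition hom_section E F (f : bundle_hom E F) (X : section E) : section F :=
  Section (hom_section_smooth f X).

Fact hom_id_smooth E (i j : trivs E) v :
  msmooth_on (tdom i `&` tdom j) (fun x => tmap j (tinv i x v)).
Proof. exact: transition_smooth. Qed.

Fact hom_id_linear E x : linear (@idfun (E x)).
Proof. by []. Qed.

Definition hom_id E : bundle_hom E E := Hom (@hom_id_linear E) (@hom_id_smooth E).

Fact hom_comp_linear E F G (f : bundle_hom F G) (g : bundle_hom E F) x :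
  linear (f x \o g x).
Proof. by move=> a u v /=; rewrite !happ_linear. Qed.

Fact hom_comp_smooth E F G (f : bundle_hom F G) (g : bundle_hom E F) (i : trivs E)
    (k : trivs G) v :
  msmooth_on (tdom i `&` tdom k) (fun x => tmap k ((f x \o g x) (tinv i x v))).
Proof.
apply: msmooth_on_local => x [ix kx]; have [j jx] := tdom_cover F x.
exists (tdom j) => //=; set U := _ `&` tdom j.
have oU : open U by do 2?apply: openI; exact: tdom_open.
apply: (@msmooth_on_eq _ _ _
  (fun x => tmap k (f x (tinv j x (tmap j (g x (tinv i x v))))))) => //.
  by move=> y [_ jy]; rewrite tmapK.
apply: (msmooth_on_app (L := fun x w => tmap k (f x (tinv j x w)))) => //.
- move=> y [[iy ky] jy] a u w.
  by rewrite (tinv_linear jy) happ_linear tmap_linear.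
- move=> w; apply: msmooth_on_sub (happ_smooth f j k w).
  by move=> y [[iy ky] jy].
- apply: msmooth_on_sub (happ_smooth g i j v).
  by move=> y [[iy ky] jy].
Qed.

Definition hom_comp E F G (f : bundle_hom F G) (g : bundle_hom E F) : bundle_hom E G :=
  Hom (hom_comp_linear f g) (hom_comp_smooth f g).

Fact hom_scale_linear E F (a : R) (f : bundle_hom E F) x :
  linear (fun u => a *: f x u).
Proof.
by move=> b u v; rewrite happ_linear scalerDr !scalerA mulrC.
Qed.

Fact hom_scale_smooth E F (a : R) (f : bundle_hom E F) (i : trivs E) (j : trivs F) v :
  msmooth_on (tdom i `&` tdom j) (fun x => tmap j (a *: f x (tinv i x v))).
Proof.
have oij : open (tdom i `&` tdom j) by apply: openI; exact: tdom_open.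
apply: msmooth_on_eq (msmooth_onZ a oij (happ_smooth f i j v)) => //.
by move=> x [ix jx]; rewrite tmapZ.
Qed.

Definition hom_scale E F (a : R) (f : bundle_hom E F) : bundle_hom E F :=
  Hom (hom_scale_linear a f) (hom_scale_smooth a f).

End HomOperations.

Section Tangent.
Variable M : smoothManifold.
Implicit Types (a b c : atlas M) (x : M).
Local Notation n := (mdim M).

(* derivative at x of the change of charts from a to b *)
Definition dchart a b x (v : 'rV[R]_n) : 'rV[R]_n :=
  'd (cmap (achart b) \o cinv (achart a)) (cmap (achart a) x) v.

Fact dchart_linear a b x : linear (dchart a b x).
Proof. by move=> r u v; rewrite /dchart linearP. Qed.

Lemma change_differentiable a b x :
  cdom (achart a) x -> cdom (achart b) x ->
  differentiable (cmap (achart b) \o cinv (achart a)) (cmap (achart a) x).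
Proof.
move=> ax bx; have [+ _] := atlas_smooth a b 1; apply; split.
  exact: cmap_cod.
by rewrite /= cmapK.
Qed.

Lemma dchart_id a x v : cdom (achart a) x -> dchart a a x v = v.
Proof.
move=> ax; have [da did] := is_diff_id (cmap (achart a) x).
have : \forall y \near cmap (achart a) x,
    id y = (cmap (achart a) \o cinv (achart a)) y.
  have oa : open_nbhs (cmap (achart a) x) (ccod (achart a)).
    by split; [exact: ccod_open|exact: cmap_cod].
  by apply: filterS (open_nbhs_nbhs oa) => y ay; rewrite /= cinvK.
move=> /near_eq_is_diff/(_ da)[_ E].
by rewrite /dchart E did.
Qed.

Lemma dchart_comp a b c x v :
  cdom (achart a) x -> cdom (achart b) x -> cdom (achart c) x ->
  dchart b c x (dchart a b x v) = dchart a c x v.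
Proof.
move=> ax bx cx.
apply: (diff_comp_near _ _ (change_differentiable ax bx)
  (change_differentiable bx cx)); first by rewrite /= cmapK.
have oab : open_nbhs (cmap (achart a) x)
    (chart_part (achart a) (cdom (achart b))).
  split; first by apply: chart_part_open; exact: cdom_open.
  by split; [exact: cmap_cod|rewrite cmapK].
by apply: filterS (open_nbhs_nbhs oab) => y [ay by_]; rewrite /= cmapK.
Qed.

Lemma dchart_smooth a b v :
  msmooth_on (cdom (achart a) `&` cdom (achart b)) (fun x => dchart a b x v).
Proof.
move=> c k; set U := chart_part _ _.
have oU : open U by apply: chart_part_open; apply: openI; exact: cdom_open.
apply: (@Cn_on_comp _ k _ _ _ U (chart_part (achart a) (cdom (achart b)))
  (cmap (achart a) \o cinv (achart c))
  (fun y => 'd (cmap (achart b) \o cinv (achart a)) y v)) => //.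
- move=> y [cy [ay by_]]; split; first exact: cmap_cod.
  by rewrite /= cmapK.
- apply: Cn_on_sub (atlas_smooth c a k).
  by move=> y [cy [ay _]].
- by have [_ ] := atlas_smooth a b k.+1; apply.
Qed.

Fact tangent_cover x : exists c, cdom (achart c) x.
Proof. by exists (chart_at x); exact: chart_atP. Qed.

(* The tangent bundle: a tangent vector at x is represented by its coordinates
   in the preferred chart at x, and its coordinates in any other chart are
   obtained by applying the derivative of the change of charts *)
Definition tangent : vbundle M.
Proof.
apply: (@VBundle M n (fun _ => 'rV[R]_n) (atlas M)
  (fun c => cdom (achart c))
  (fun c x => dchart (chart_at x) c x)
  (fun c x => dchart c (chart_at x) x)).
- by move=> c; exact: cdom_open.
- exact: tangent_cover.
- by move=> c x _; exact: dchart_linear.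
- move=> c x cx v; have xx := chart_atP x.
  by rewrite dchart_comp // dchart_id.
- move=> c x cx v; have xx := chart_atP x.
  by rewrite dchart_comp // dchart_id.
- move=> a b v; apply: msmooth_on_eq (dchart_smooth a b v).
    by apply: openI; exact: cdom_open.
  by move=> x [ax bx]; have xx := chart_atP x; rewrite dchart_comp.
Defined.

(* derivative of the function f along the tangent vector v *)
Definition tangent_act x (v : tangent x) (f : M -> R) : R :=
  'd (f \o cinv (achart (chart_at x))) (cmap (achart (chart_at x)) x)
    (v : 'rV[R]_n).

End Tangent.

Section Courant.
Variables (M : smoothManifold) (E : vbundle M).

Record pseudo_euclidean := PseudoEuclidean {
  form :> forall x, E x -> E x -> R ;
  form_sym : forall x (u v : E x), form u v = form v u ;
  form_linear : forall x (u : E x) a v w,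
    form u (a *: v + w) = a * form u v + form u w ;
  form_nondeg : forall x (u : E x), (forall v, form u v = 0) -> u = 0 ;
  form_smooth : forall (i : trivs E) v w,
    msmooth_on (tdom i) (fun x => form (tinv i x v) (tinv i x w)) }.

(* a pair (anchor, bracket), before any axiom is imposed on it *)
Record courant_data := CourantData {
  anchor : bundle_hom E (tangent M) ;
  bracket : section E -> section E -> section E }.

Definition courant_scale (c : R) (Theta : courant_data) : courant_data :=
  CourantData (hom_scale c (anchor Theta))
            (fun X Y => c *: bracket Theta X Y).

Definition deform (Theta : courant_data) (I : bundle_hom E E) : courant_data :=
  CourantData (hom_comp (anchor Theta) I)
    (fun X Y => bracket Theta (hom_section I X) Y
      + bracket Theta X (hom_section I Y)
      - hom_section I (bracket Theta X Y)).

Variable g : pseudo_euclidean.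

Definition pairing (X Y : section E) : M -> R := fun x => g x (X x) (Y x).

Definition anchor_act (Theta : courant_data) (X : section E) (f : M -> R) : M -> R :=
  fun x => tangent_act (anchor Theta x (X x)) f.

Definition pre_courant (Theta : courant_data) : Prop :=
  [/\ forall X, linear (bracket Theta X),
      forall Y, linear (bracket Theta ^~ Y),
      forall X Y Z x, anchor_act Theta X (pairing Y Z) x =
        pairing (bracket Theta X Y) Z x + pairing Y (bracket Theta X Z) x
    & forall X Y Z x, anchor_act Theta X (pairing Y Z) x =
        pairing X (bracket Theta Y Z + bracket Theta Z Y) x].

Definition skew (I : bundle_hom E E) : Prop :=
  forall x (u v : E x), g x (I x u) v = - g x u (I x v).

(* Indices live in 'Z_3, where 3 = 0. *)
Definition eps_hypersymplectic (eps : 'Z_3 -> R) (Theta : courant_data)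
    (S : 'Z_3 -> bundle_hom E E) : Prop :=
  [/\ forall i, skew (S i),
      forall i, hom_comp (S i) (S i) = hom_scale (eps i) (hom_id E),
      forall i j, i != j -> hom_comp (S i) (S j) =
        hom_scale (eps 1 * eps 2 * eps 3) (hom_comp (S j) (S i))
    & forall i, deform (deform Theta (S i)) (S i) =
        courant_scale (eps i) Theta].

Definition hypersymplectic (eps : 'Z_3 -> R) (Theta : courant_data)
    (S : 'Z_3 -> bundle_hom E E) : Prop :=
  (forall i, eps i = -1) /\ eps_hypersymplectic eps Theta S.

(* the triples eps allowed here are the cyclic permutations of (1, 1, -1) *)
Definition para_hypersymplectic (eps : 'Z_3 -> R) (Theta : courant_data)
    (S : 'Z_3 -> bundle_hom E E) : Prop :=
  [/\ eps 1 * eps 2 * eps 3 = -1, ~ (forall i, eps i = -1)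
    & eps_hypersymplectic eps Theta S].

Definition pseudo_metric (S : 'Z_3 -> bundle_hom E E) : bundle_hom E E :=
  hom_comp (S 3) (hom_comp (S 2) (S 1)).

Definition transform (eps : 'Z_3 -> R) (S : 'Z_3 -> bundle_hom E E) : 'Z_3 -> bundle_hom E E :=
  fun i => hom_scale (eps (i - 1)) (hom_comp (S (i - 1)) (S (i + 1))).

Definition triplet (S1 S2 S3 : bundle_hom E E) : 'Z_3 -> bundle_hom E E :=
  fun i => if i == 1 then S1 else if i == 2 then S2 else S3.

End Courant.

End Manifolds.

Arguments smoothManifold : clear implicits.

(* Main.v *)
(** When [S_i^2 = eps_i], the condition [Theta_{S_i,S_i} = eps_i Theta] says that
    the Nijenhuis torsion of [S_i] for the bracket vanishes; on anchors it is
    automatic. For an arbitrary bilinear bracket, the composite of two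
    anticommuting endomorphisms with vanishing torsion has vanishing torsion.
    Hence if (S1, S2, S3) is a structure then so is (S1, c S1 S3, d S1 S2) for
    all signs c and d. Applied to S this gives (S1, T2, T3); applied to
    (S1, T2, T3) it gives S back, because S1 T2 = S3 and S1 T3 = - eps1 eps2 S2. *)
Require Import Defs.
From HB Require Import structures.
From mathcomp Require Import all_boot all_order all_algebra.
From mathcomp Require Import all_classical all_reals all_analysis.
Set Implicit Arguments. Unset Strict Implicit. Unset Printing Implicit Defensive.
Import GRing.Theory.
Local Open Scope ring_scope.

(** * Nijenhuis torsion for an arbitrary bilinear bracket on a module *)

Section Nijenhuis.
Variables (R : numFieldType) (V : lmodType R) (mu : V -> V -> V).
Hypotheses (mu_linl : forall y, linear (mu^~ y)) (mu_linr : forall x, linear (mu x)).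

Lemma addrr_eq0 (v : V) : v + v = 0 -> v = 0.
Proof.
rewrite -mulr2n -scaler_nat => /eqP.
by rewrite scaler_eq0 Num.Theory.pnatr_eq0 => /eqP.
Qed.

Lemma bilZl a x y : mu (a *: x) y = a *: mu x y.
Proof.
pose lM := GRing.isLinear.Build _ _ _ _ _ (mu_linl y).
pose l : {linear V -> V} := HB.pack (mu^~ y) lM.
exact: (linearZ_LR l).
Qed.

Lemma bilZr a x y : mu x (a *: y) = a *: mu x y.
Proof.
pose lM := GRing.isLinear.Build _ _ _ _ _ (mu_linr x).
pose l : {linear V -> V} := HB.pack (mu x) lM.
exact: (linearZ_LR l).
Qed.

Lemma bilNl x y : mu (- x) y = - mu x y.
Proof. by rewrite -scaleN1r bilZl scaleN1r. Qed.

Lemma bilNr x y : mu x (- y) = - mu x y.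
Proof. by rewrite -scaleN1r bilZr scaleN1r. Qed.

(* For [I^2 = a] this says that the Nijenhuis torsion of [I] vanishes. *)
Definition nijenhuis (a : R) (I : V -> V) := forall x y,
  I (mu (I x) y + mu x (I y)) = mu (I x) (I y) + a *: mu x y.

(** Every term of the identity except [a *: mu x y] is quadratic in [I], so only [c * c = 1]
    enters. *)
Lemma nijenhuis_scale (a c : R) (I : {linear V -> V}) : c * c = 1 ->
  nijenhuis a I -> nijenhuis a (fun x => c *: I x).
Proof.
move=> cc NI x y; rewrite !(bilZl, bilZr) -scalerDr linearZ /= !scalerA cc.
by rewrite !scale1r NI.
Qed.

(** By anticommutation the argument of [J] is the sum of those in the identity for [J] at [(I x, y)]
    and [(x, I y)]. Its image is a combination of the arguments in the identity for [I] at
    [(J x, J y)] and [(x, y)]. *)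
Lemma nijenhuis_half (a b : R) (I J : {linear V -> V}) :
  (forall x, J (I x) = - I (J x)) ->
  nijenhuis a I -> nijenhuis b J -> forall x y,
  I (J (mu (I x) (J y) + mu (J x) (I y) - (mu (I (J x)) y + mu x (I (J y))))) =
  b *: mu (I x) (I y) - a *: mu (J x) (J y)
    + (a * b) *: mu x y - mu (I (J x)) (I (J y)).
Proof.
move=> JI NI NJ x y.
have -> : mu (I x) (J y) + mu (J x) (I y) - (mu (I (J x)) y + mu x (I (J y)))
   = (mu (J (I x)) y + mu (I x) (J y)) + (mu (J x) (I y) + mu x (J (I y))).
  by rewrite !JI bilNl bilNr opprD addrACA (addrC (- _)).
rewrite linearD NJ NJ !JI bilNl bilNr.
have -> : - mu (I (J x)) (J y) + b *: mu (I x) y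
    + (- mu (J x) (I (J y)) + b *: mu x (I y))
  = - (mu (I (J x)) (J y) + mu (J x) (I (J y))) + b *: (mu (I x) y + mu x (I y)).
  by rewrite addrACA -opprD -scalerDr.
rewrite linearD linearN linearZ /= !NI opprD scalerDr scalerA (mulrC b).
by rewrite [LHS](AC (2*2) (3*2*4*1)).
Qed.

(* Each order of composition gives one half of the torsion of [I J], up to terms
   that cancel when the two are added. *)
Lemma nijenhuis_comp (a b : R) (I J : {linear V -> V}) :
  (forall x, J (I x) = - I (J x)) ->
  nijenhuis a I -> nijenhuis b J -> nijenhuis (- (a * b)) (I \o J).
Proof.
move=> JI NI NJ x y /=.
have IJ z : I (J z) = - J (I z) by rewrite JI opprK.
have := nijenhuis_half JI NI NJ x y.
have := nijenhuis_half IJ NJ NI x y.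
rewrite !JI !(bilNl, bilNr) opprK (mulrC b).
set F := mu (I x) (J y) + _; rewrite [mu (J x) (I y) + _]addrC -/F.
set D := _ + mu x (I (J y)); set K := mu (I (J x)) (I _).
rewrite -opprD -/D opprK.
have IJD G H : I (J (G + H)) = I (J G) + I (J H) by rewrite !linearD.
have IJB G H : I (J (G - H)) = I (J G) - I (J H) by rewrite !linearB.
rewrite IJD IJB opprD.
set P := I (J F); set Q := I (J D); set A := b *: _; set B := a *: _.
set m := (a * b) *: _ => h1 h2; rewrite scaleNr -/m.
(* The halves read [P - Q = A - B + m - K] and [- P - Q = B - A + m - K]; their sum is twice the
   claim [Q = K - m]. *)
apply/eqP; rewrite -subr_eq0; apply/eqP; apply: addrr_eq0.
have -> : Q - (K - m) = m - K + Q by rewrite opprB addrC.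
have -> : m - K + Q + (m - K + Q) = (B - A + m - K) + (A - B + m - K) + (Q + Q).
  rewrite -(opprB A B) [RHS](AC (3*3*2) ((1*4)*(2*3*7)*(5*6*8))) /=.
  by rewrite addNr add0r.
by rewrite -h1 -h2 [_ + (P - Q)]addrACA addNr add0r -opprD addNr.
Qed.

End Nijenhuis.

(** * Bundle morphisms acting on the module of sections *)

Section HomSection.
Context {R : realType} (M : smoothManifold R).
Implicit Types E F : vbundle M.

Lemma happZ E F (f : bundle_hom E F) x a (u : E x) : f x (a *: u) = a *: f x u.
Proof.
pose lM := GRing.isLinear.Build _ _ _ _ _ (@happ_linear _ _ _ _ f x).
pose l : {linear E x -> F x} := HB.pack (happ f (x := x)) lM.
exact: (linearZ_LR l).
Qed.

Lemma happN E F (f : bundle_hom E F) x (u : E x) : f x (- u) = - f x u.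
Proof. by rewrite -scaleN1r happZ scaleN1r. Qed.

Fact hom_section_linear E F (f : bundle_hom E F) : linear (hom_section f).
Proof. by move=> a X Y; apply: sectionP => x; exact: happ_linear. Qed.

(** Makes the torsion lemmas for linear maps available with [section E] as the module. *)
HB.instance Definition _ E F (f : bundle_hom E F) :=
  GRing.isLinear.Build R (section E) (section F) _ (hom_section f)
    (hom_section_linear f).

Lemma hom_section_comp E F G (f : bundle_hom F G) (h : bundle_hom E F) X :
  hom_section (hom_comp f h) X = hom_section f (hom_section h X).
Proof. exact: sectionP. Qed.

Lemma hom_section_scale E F a (f : bundle_hom E F) X :
  hom_section (hom_scale a f) X = a *: hom_section f X.
Proof. exact: sectionP. Qed.

Lemma hom_section_id E (X : section E) : hom_section (hom_id E) X = X.
Proof. exact: sectionP. Qed.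

End HomSection.

(** * Double deformations, and structures built from composites *)

Section Courant.
Context {R : realType} (M : smoothManifold R) (E : vbundle M).
Variables (g : pseudo_euclidean E) (Theta : courant_data E).
Hypothesis bracket_linl : forall Y, linear (bracket Theta ^~ Y).
Hypothesis bracket_linr : forall X, linear (bracket Theta X).

(** The doubled summand is the Nijenhuis torsion of [I]. In the expansion [a *: bracket Theta X Y]
    occurs three times, from [I^2] on [X], on [Y] and on the bracket; every other term occurs
    twice. *)
Lemma deform2_bracket a (I : bundle_hom E E) :
  hom_comp I I = hom_scale a (hom_id E) -> forall X Y,
  bracket (deform (deform Theta I) I) X Y = a *: bracket Theta X Y
    + (bracket Theta (hom_section I X) (hom_section I Y) + a *: bracket Theta X Y
       - hom_section I (bracket Theta (hom_section I X) Y
                        + bracket Theta X (hom_section I Y))) *+ 2.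
Proof.
move=> I2 X Y.
have II Z : hom_section I (hom_section I Z) = a *: Z.
  by rewrite -hom_section_comp I2 hom_section_scale hom_section_id.
rewrite /= !II (bilZl bracket_linl) (bilZr bracket_linr).
rewrite [hom_section I (_ - _)]linearB /= II ![hom_section I (_ + _)]linearD /=.
move: (bracket Theta (hom_section I X) (hom_section I Y)) => P.
move: (hom_section I (bracket _ (hom_section _ _) _)) => q.
move: (hom_section I (bracket _ _ (hom_section _ _))) => r.
move: (a *: bracket Theta X Y) => m.
rewrite mulr2n opprB [m + P - q + _]addrACA -opprD [P + m]addrC.
by rewrite [RHS](AC (1*(2*2)) (2*4*3*(1*5))).
Qed.

Lemma deform2E a (I : bundle_hom E E) :
  hom_comp I I = hom_scale a (hom_id E) ->
  deform (deform Theta I) I = courant_scale a Theta <->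
  nijenhuis (bracket Theta) a (hom_section I).
Proof.
move=> I2; split=> [D X Y|NI].
  have := congr1 (fun T => bracket T X Y) D; rewrite (deform2_bracket I2) /=.
  move=> /(canRL (addKr _)); rewrite addNr mulr2n => /addrr_eq0 /eqP.
  by rewrite subr_eq0 => /eqP.
rewrite /courant_scale.
(* Exposing the constructor separates the anchor, settled by [I^2 = a] alone, from the bracket,
   where the torsion enters. *)
have -> : deform (deform Theta I) I =
    CourantData (hom_comp (hom_comp (anchor Theta) I) I)
      (bracket (deform (deform Theta I) I)) by [].
congr CourantData.
  apply: homP => x u /=.
  by rewrite -[I x (I x u)]/(hom_comp I I x u) I2 /= happZ.
by apply/funext => X; apply/funext => Y; rewrite (deform2_bracket I2) NI subrr mul0rn addr0.
Qed.

Lemma form_scaler a x (u v : E x) : g x u (a *: v) = a * g x u v.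
Proof.
have g0 : g x u 0 = 0.
  have /esym/eqP := form_linear g u 1 0 0.
  by rewrite scaler0 addr0 mul1r -subr_eq0 addrK => /eqP.
by have := form_linear g u a v 0; rewrite !addr0 g0 addr0.
Qed.

Lemma ord3_ind (P : 'Z_3 -> Prop) : P 1 -> P 2 -> P 3 -> forall i, P i.
Proof.
(* The ordinals come in the order 0, 1, 2, and 0 is the index 3. *)
move=> P1 P2 P3 [[|[|[|//]]] i3].
- by rewrite (_ : Ordinal i3 = 3) //; apply/val_inj.
- by rewrite (_ : Ordinal i3 = 1) //; apply/val_inj.
- by rewrite (_ : Ordinal i3 = 2) //; apply/val_inj.
Qed.

Lemma eps_hypersymplectic_comp (eps : 'Z_3 -> R) (c d : R) (S : 'Z_3 -> bundle_hom E E) :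
  eps 1 * eps 2 * eps 3 = -1 -> eps 2 * eps 2 = 1 -> eps 3 * eps 3 = 1 -> c * c = 1 -> d * d = 1 ->
  eps_hypersymplectic g eps Theta S ->
  eps_hypersymplectic g eps Theta
    (triplet (S 1) (hom_scale c (hom_comp (S 1) (S 3)))
                   (hom_scale d (hom_comp (S 1) (S 2)))).
Proof.
move=> e123 e22 e33 cc dd [Sskew Ssq Santi Snij].
have sq i x u : S i x (S i x u) = eps i *: u.
  by rewrite -[LHS]/(hom_comp (S i) (S i) x u) Ssq.
have anti i j x u : i != j -> S i x (S j x u) = - S j x (S i x u).
  move=> ij; rewrite -[LHS]/(hom_comp (S i) (S j) x u) Santi // e123.
  by rewrite /= scaleN1r.
(* The adjoint of [S i S j] is [S j S i], which anticommutation turns into [- S i S j]. *)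
have skew2 a i j : i != j -> Defs.skew g (hom_scale a (hom_comp (S i) (S j))).
  move=> ij x u v /=; rewrite form_sym !form_scaler form_sym !Sskew opprK.
  by rewrite (anti j i) 1?eq_sym // -scaleN1r form_scaler mulN1r mulrN.
have nij2 a i j : i != j -> a * a = 1 ->
    nijenhuis (bracket Theta) (- (eps i * eps j))
      (hom_section (hom_scale a (hom_comp (S i) (S j)))).
  move=> ij aa X Y.
  have E1 Z : hom_section (hom_scale a (hom_comp (S i) (S j))) Z =
     a *: (hom_section (S i) \o hom_section (S j)) Z.
    by rewrite hom_section_scale hom_section_comp.
  rewrite !E1; apply: (nijenhuis_scale bracket_linl bracket_linr aa).
  apply: (nijenhuis_comp bracket_linl bracket_linr).
  - move=> Z; apply: sectionP => x; rewrite sectionNE.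
    by apply: anti; rewrite eq_sym.
  - exact/deform2E.
  - exact/deform2E.
have sq2 a i j : i != j -> a * a = 1 ->
    hom_comp (hom_scale a (hom_comp (S i) (S j))) (hom_scale a (hom_comp (S i) (S j)))
     = hom_scale (- (eps i * eps j)) (hom_id E).
  move=> ij aa; apply: homP => x u /=.
  rewrite !happZ scalerA aa scale1r (anti j i) 1?eq_sym //.
  by rewrite happN !sq scaleNr scalerA.
have n13 : (1 : 'Z_3) != 3 by []. have n12 : (1 : 'Z_3) != 2 by [].
have n23 : (2 : 'Z_3) != 3 by [].
(* As the three signs multiply to -1, the squares of the composites are exactly those prescribed at
   indices 2 and 3. *)
have e2 : - (eps 1 * eps 3) = eps 2.
  by rewrite -[LHS]mulr1 -e22 mulNr mulrA (mulrAC (eps 1)) e123 mulN1r opprK.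
have e3 : - (eps 1 * eps 2) = eps 3.
  by rewrite -[LHS]mulr1 -e33 mulNr mulrA e123 mulN1r opprK.
set T := triplet _ _ _.
have T1 : T 1 = S 1 by [].
have T2 : T 2 = hom_scale c (hom_comp (S 1) (S 3)) by [].
have T3 : T 3 = hom_scale d (hom_comp (S 1) (S 2)) by [].
have Tsq i : hom_comp (T i) (T i) = hom_scale (eps i) (hom_id E).
  elim/ord3_ind: i; rewrite ?T1 ?T2 ?T3.
  - exact: Ssq.
  - by rewrite sq2 // e2.
  - by rewrite sq2 // e3.
split=> //.
- elim/ord3_ind; rewrite ?T1 ?T2 ?T3; [exact: Sskew|exact: skew2|exact: skew2].
(* Anticommutation is symmetric in the indices, so three pairs suffice. *)
- have Tanti i j : (i, j) \in [:: (1, 2); (1, 3); (2, 3)] -> forall x u,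
      T i x (T j x u) = - T j x (T i x u).
    rewrite !inE => /or3P[] /eqP[-> ->] x u; rewrite ?T1 ?T2 ?T3 /=.
    + by rewrite happZ (anti 3 1) // !happN scalerN opprK.
    + by rewrite happZ (anti 2 1) // !happN scalerN opprK.
    (* Moving the inner [S 1] outwards leaves [S 3 S 2] on one side and [S 2 S 3] on the other, with
       equal coefficients. *)
    + rewrite !happZ !scalerA [d * c]mulrC -scalerN (anti 3 1) //.
      by rewrite (anti 2 1) // !happN !sq (anti 3 2) // !scalerN !opprK.
  move=> i j ij; apply: homP => x u; rewrite e123 /= scaleN1r.
  have [/Tanti-> //|/Tanti->] : (i, j) \in [:: (1, 2); (1, 3); (2, 3)] \/
      (j, i) \in [:: (1, 2); (1, 3); (2, 3)]; last by rewrite opprK.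
  by move: ij; elim/ord3_ind: i; elim/ord3_ind: j => // _; auto.
- move=> i; apply/deform2E => //; move: i; elim/ord3_ind; rewrite ?T1 ?T2 ?T3.
  + exact/deform2E.
  + by rewrite -e2; exact: nij2.
  + by rewrite -e3; exact: nij2.
Qed.

End Courant.

Theorem theorem6p9 (R : realType) (M : smoothManifold R) (E : vbundle M)
    (g : pseudo_euclidean E) (Theta : courant_data E)
    (hTheta : pre_courant g Theta)
    (eps : 'Z_3 -> R) (heps : forall i, eps i = 1 \/ eps i = -1)
    (S : 'Z_3 -> bundle_hom E E) :
  let T := transform eps S in
  let S' := triplet (S 1) (T 2) (T 3) in
  [/\ hypersymplectic g eps Theta S <-> hypersymplectic g eps Theta S',
      para_hypersymplectic g eps Theta S <->
        para_hypersymplectic g eps Theta S'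
    & hypersymplectic g eps Theta S \/ para_hypersymplectic g eps Theta S ->
        pseudo_metric S' = pseudo_metric S \/
        pseudo_metric S' = hom_scale (-1) (pseudo_metric S)].

Proof.
case: hTheta => bracket_linr bracket_linl _ _ T S'.
have ee i : eps i * eps i = 1.
  by have [->|->] := heps i; rewrite ?mulr1 // mulrNN mulr1.
(* The shifted indices are computed modulo 3, so that [3 + 1] is 1. *)
have T2 : T 2 = hom_scale (eps 1) (hom_comp (S 1) (S 3)).
  by congr (hom_scale (eps _) (hom_comp (S _) (S _))); apply/val_inj.
have T3 : T 3 = hom_scale (eps 2) (hom_comp (S 2) (S 1)).
  by congr (hom_scale (eps _) (hom_comp (S _) (S _))); apply/val_inj.
have forth : eps 1 * eps 2 * eps 3 = -1 ->
    eps_hypersymplectic g eps Theta S -> eps_hypersymplectic g eps Theta S'.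
  move=> e123 HS; have [_ _ Santi _] := HS.
  (* [T 3] has its factors in the order [S 2 S 1]; swapping them makes the second sign [- eps 2]. *)
  have -> : S' = triplet (S 1) (hom_scale (eps 1) (hom_comp (S 1) (S 3)))
      (hom_scale (- eps 2) (hom_comp (S 1) (S 2))).
    rewrite /S' T2 T3 (Santi 2 1) // e123; congr triplet.
    by apply: homP => x u /=; rewrite scaleN1r scalerN scaleNr.
  by apply: eps_hypersymplectic_comp; rewrite ?mulrNN ?ee.
have back : eps 1 * eps 2 * eps 3 = -1 ->
    eps_hypersymplectic g eps Theta S' -> eps_hypersymplectic g eps Theta S.
  move=> e123 HS; have [_ Ssq Santi _] := HS.
  have S11 x u : S 1 x (S 1 x u) = eps 1 *: u.
    by rewrite -[LHS]/(hom_comp (S' 1) (S' 1) x u) Ssq.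
  (* Only [S'] is known to anticommute here: [S' 1 S' 3 = - T 3 S 1 = - eps 2 S 2 (S 1)^2] dictates
     the sign [- (eps 1 * eps 2)]. *)
  have {1}-> : S = triplet (S' 1) (hom_scale (- (eps 1 * eps 2)) (hom_comp (S' 1) (S' 3)))
      (hom_scale 1 (hom_comp (S' 1) (S' 2))).
    apply/funext; elim/ord3_ind => //; apply: homP => x u.
      rewrite -[RHS]/(- (eps 1 * eps 2) *: hom_comp (S' 1) (S' 3) x u).
      rewrite (Santi 1 3) // e123 -[hom_comp _ _]/(hom_comp (T 3) (S 1)) T3 /=.
      rewrite scaleN1r scalerN scaleNr opprK S11 happZ !scalerA.
      by rewrite -(mulrA (eps 1)) ee mulr1 ee scale1r.
    rewrite -[RHS]/(1 *: S 1 x (T 2 x u)) scale1r T2 /= happZ S11 scalerA.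
    by rewrite ee scale1r.
  apply: eps_hypersymplectic_comp; rewrite ?mulrNN ?mulr1 //.
  by rewrite mulrACA !ee mulr1.
have iff_S : eps 1 * eps 2 * eps 3 = -1 ->
    eps_hypersymplectic g eps Theta S <-> eps_hypersymplectic g eps Theta S'.
  by move=> e1; split; [exact: forth|exact: back].
have prodN1 : (forall i, eps i = -1) -> eps 1 * eps 2 * eps 3 = -1.
  by move=> eN; rewrite !eN mulrNN mulr1 mul1r.
split.
- by split=> -[eN H]; split=> //; apply/iff_S => //; exact: prodN1.
- by split=> -[e1 eN H]; split=> //; apply/iff_S.
- move=> H; have [e123 [_ Ssq Santi _]] :
      eps 1 * eps 2 * eps 3 = -1 /\ eps_hypersymplectic g eps Theta S.
    by case: H => [[/prodN1]|[]].
  (* In [T 3 T 2 S 1] the two adjacent [S 1] give [eps 1], cancelling the [eps 1] of [T 2]; swapping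
     [S 2] and [S 3] gives the minus sign. Hence the pseudo-metrics agree for [eps 2 = -1] and are
     opposite for [eps 2 = 1]. *)
  have ST x u : pseudo_metric S' x u = - (eps 2 *: pseudo_metric S x u).
    rewrite -[LHS]/(T 3 x (T 2 x (S 1 x u))) T2 T3 /= !happZ scalerA.
    rewrite -[S 1 x (S 1 x _)]/(hom_comp (S 1) (S 1) x _) Ssq /= happZ scalerA.
    rewrite -mulrA ee mulr1 -[S 2 x (S 3 x _)]/(hom_comp (S 2) (S 3) x _).
    by rewrite (Santi 2 3) // e123 /= scaleN1r scalerN.
  have [h|h] := heps 2; [right|left]; apply: homP => x u; rewrite ST h.
    by rewrite /= scale1r scaleN1r.
  by rewrite scaleN1r opprK.
Qed.
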